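(* Let $\alpha\in[0,\tfrac12)$ and let $M=(M_\omega)_{\omega\in\Omega}$ be a quantum measurement that is $\alpha$-gentle on $\mathcal S(\mathbb C^d)$. Then $M$ is $\delta$-quantum-differentially-private on $\mathcal S(\mathbb C^d)$ for $$\delta=2\log\Big(\frac{1+2\alpha}{1-2\alpha}\Big).$$
   Context: $\mathcal S(\mathbb C^d)$ is the set of density matrices (positive semidefinite, trace 1) on $\mathbb C^d$. A measurement on $\mathbb C^d$ is a countable family $M=(M_\omega)_{\omega\in\Omega}$ of matrices in $\mathbb C^{d\times d}$ with $\sum_\omega M_\omega^*M_\omega=\mathbb 1$; put $E_\omega=M_\omega^*M_\omega$. Measuring $\rho$ yields a random outcome $R^M$ with $\mathbb P_\rho(R^M=\omega)=\operatorname{Tr}[\rho E_\omega]$ and, if this is positive, the post-measurement state $\rho_{M\to\omega}=M_\omega\rho M_\omega^*/\operatorname{Tr}[\rho E_\omega]$. With $\|A\|_{Tr}=\frac12\operatorname{Tr}|A|$, $M$ is $\alpha$-gentle on $\mathcal S\subseteq\mathcal S(\mathbb C^d)$ if $\|\rho-\rho_{M\to\omega}\|_{Tr}\le\alpha$ for all $\rho\in\mathcal S$ and all outcomes $\omega$ (of positive probability). $M$ is $\delta$-quantum-differentially-private on $\mathcal S$ if $\mathbb P_{\rho_1}(R^M=\omega)\le e^\delta\,\mathbb P_{\rho_2}(R^M=\omega)$ for all $\rho_1,\rho_2\in\mathcal S$ and $\omega\in\Omega$. *)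

(* Defs.v *)
From mathcomp Require Import all_boot all_order all_algebra finmap.
From mathcomp Require Import all_classical all_reals all_analysis.
From mathcomp Require Import complex.
From mathcomp.analysis Require showcase.summability.

Set Implicit Arguments.
Unset Strict Implicit.
Unset Printing Implicit Defensive.

Import Order.TTheory GRing.Theory Num.Theory numFieldNormedType.Exports.
Local Open Scope ring_scope.
Local Open Scope classical_set_scope.
Local Open Scope sesquilinear_scope.

Section PositiveMatrices.
Context {C : numClosedFieldType} {d : nat}.
Implicit Types A : 'M[C]_d.

(* The order of [C] is partial: [0 <= z] entails that [z] is real. *)
Definition psdmx A : Prop :=
  A \is hermsymmx /\ forall u : 'cV[C]_d, 0 <= (u ^t* *m A *m u) 0 0.

(* Square root by spectral calculus: [A = P^-1 *m diag_mx s *m P] with [P]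
   unitary for normal [A]; the value is meaningful for psd [A] only. *)
Definition sqrtmx A : 'M[C]_d :=
  invmx (spectralmx A) *m diag_mx (map_mx sqrtC (spectral_diag A))
    *m spectralmx A.

Definition absmx A : 'M[C]_d := sqrtmx (A ^t* *m A).

Lemma diag_mx_form_ge0 (s : 'rV[C]_d) (P : 'M[C]_d) (u : 'cV[C]_d) :
  (forall i, 0 <= s 0 i) ->
  0 <= (u ^t* *m (P ^t* *m diag_mx s *m P) *m u) 0 0.
Proof.
move=> s_ge0; set v := P *m u.
have -> : u ^t* *m (P ^t* *m diag_mx s *m P) *m u = v ^t* *m diag_mx s *m v.
  by rewrite /v trmx_mul map_mxM !mulmxA.
rewrite mxE; apply: sumr_ge0 => i _.
by rewrite mul_mx_diag !mxE mulrAC mulrC mulr_ge0 // mulrC -normCK exprn_ge0.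
Qed.

Lemma gram_hermsymmx A : A ^t* *m A \is hermsymmx.
Proof.
by apply/is_hermitianmxP; rewrite expr0 scale1r trmx_mul map_mxM trmxCK.
Qed.

Lemma gram_spectralE A :
  A ^t* *m A = (spectralmx (A ^t* *m A)) ^t*
    *m diag_mx (spectral_diag (A ^t* *m A)) *m spectralmx (A ^t* *m A).
Proof.
have /orthomx_spectralP E := hermitian_normalmx (gram_hermsymmx A).
by rewrite {1}E invmx_unitary // spectral_unitarymx.
Qed.

Lemma gram_spectral_diag_ge0 A i : 0 <= spectral_diag (A ^t* *m A) 0 i.
Proof.
set B := A ^t* *m A; set P := spectralmx B.
have PU : P \is unitarymx by exact: spectral_unitarymx.
have PPt : P *m P ^t* = 1%:M by exact/unitarymxP.
have : 0 <= ((A *m P ^t*) ^t* *m (A *m P ^t*)) i i.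
  rewrite mxE; apply: sumr_ge0 => k _.
  by rewrite 2!mxE mulrC -normCK exprn_ge0.
have -> : (A *m P ^t*) ^t* *m (A *m P ^t*) = P *m B *m P ^t*.
  by rewrite trmx_mul map_mxM trmxCK /B !mulmxA.
have BE : B = P ^t* *m diag_mx (spectral_diag B) *m P by exact: gram_spectralE.
rewrite [X in _ *m X *m _]BE !mulmxA PPt mul1mx -mulmxA PPt mulmx1.
by rewrite mxE eqxx mulr1n.
Qed.

Lemma absmx_psd A : psdmx (absmx A).
Proof.
rewrite /absmx /sqrtmx invmx_unitary ?spectral_unitarymx //.
have s_ge0 i : 0 <= map_mx sqrtC (spectral_diag (A ^t* *m A)) 0 i.
  by rewrite mxE sqrtC_ge0 gram_spectral_diag_ge0.
split; last by move=> u; exact: diag_mx_form_ge0.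
apply/is_hermitianmxP; rewrite expr0 scale1r !trmx_mul !map_mxM trmxCK mulmxA.
congr (_ *m _ *m _); apply/matrixP => i j; rewrite !mxE eq_sym.
case: eqVneq => [->|_]; last by rewrite !mulr0n rmorph0.
rewrite !mulr1n; apply/esym/CrealP; apply: ger0_real.
by rewrite sqrtC_ge0 gram_spectral_diag_ge0.
Qed.

Lemma absmx_sqr A : absmx A *m absmx A = A ^t* *m A.
Proof.
set P := spectralmx (A ^t* *m A).
have PU : P \is unitarymx by exact: spectral_unitarymx.
have PPt : P *m P ^t* = 1%:M by exact/unitarymxP.
rewrite [RHS]gram_spectralE /absmx /sqrtmx -/P invmx_unitary // !mulmxA.
rewrite -[_ *m P *m P ^t*]mulmxA PPt mulmx1 -[_ *m diag_mx _ *m diag_mx _]mulmxA.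
congr (_ *m _ *m _); apply/matrixP => i j.
rewrite mul_diag_mx !mxE; case: eqVneq => [->|_]; last by rewrite !mulr0n mulr0.
by rewrite !mulr1n -expr2 sqrtCK.
Qed.

End PositiveMatrices.

Section QuantumMeasurements.
Context {R : realType} {d : nat} {Omega : countType}.
Implicit Types (A rho : 'M[R[i]]_d) (M : Omega -> 'M[R[i]]_d) (w : Omega).
Implicit Types (S : set 'M[R[i]]_d).

(* [\tr (absmx A)] is a nonnegative real, see [absmx_psd]. *)
Definition trace_norm A : R := complex.Re (\tr (absmx A)) / 2.

Definition effect M w : 'M[R[i]]_d := (M w) ^t* *m M w.

(* The completeness relation is an unordered sum over the countable type
   [Omega]: the limit of finite partial sums along inclusion of finite sets.
   [R[i]^o] carries the usual topology of the complex plane. *)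
Definition measurement M : Prop :=
  (fun F : {fset Omega} => \sum_(w <- F) effect M w : 'M[R[i]^o]_d)
    @ summability.totally --> (1%:M : 'M[R[i]^o]_d).

(* The trace is real whenever [rho] is Hermitian. *)
Definition outcome_prob M rho w : R := complex.Re (\tr (rho *m effect M w)).

Definition post_state M rho w : 'M[R[i]]_d :=
  (\tr (rho *m effect M w))^-1 *: (M w *m rho *m (M w) ^t*).

Definition gentle (alpha : R) S M : Prop :=
  forall rho w, S rho -> 0 < outcome_prob M rho w ->
    trace_norm (rho - post_state M rho w) <= alpha.

Definition quantum_dp (delta : R) S M : Prop :=
  forall rho1 rho2 w, S rho1 -> S rho2 ->
    outcome_prob M rho1 w <= expR delta * outcome_prob M rho2 w.

End QuantumMeasurements.

Definition density_matrices (R : realType) (d : nat) : set 'M[R[i]]_d :=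
  [set rho | psdmx rho /\ \tr rho = 1].
Arguments density_matrices : clear implicits.

(* Main.v *)
Require Import Defs.
From mathcomp Require Import all_boot all_order all_algebra.
From mathcomp Require Import all_classical all_reals all_analysis.
From mathcomp Require Import complex lra.
Import Order.TTheory GRing.Theory Num.Theory.
Local Open Scope ring_scope.

(** Measuring performs a Bayesian update, and a large likelihood ratio makes
    that update move the state a lot.  Take orthonormal vectors [u] and [v]
    on which the outcome [w] has probabilities [a] and [b], and measure the
    mixture [t uu* + (1 - t) vv*].  The probability of finding [u] is [t]
    before the measurement.  After it, the component [uu*] carries the weight
    [q = t a / (t a + (1 - t) b)]; as gentleness on [uu*] alone keeps the
    overlap of that component with [u] at least [1 - alpha], the probability
    of finding [u] has become at least [q (1 - alpha)].  Gentleness on the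
    mixture bounds it by [t + alpha], whence [q - t <= alpha (1 + q)], which
    is at most [2 alpha].  For [t = 1/2 - alpha] this forces [a / b] to be at
    most [K ^ 2], where [K = (1 + 2 alpha) / (1 - 2 alpha)]
    ([gentle_orthonormal_ratio]).

    The only property of the trace norm that enters is that it dominates the
    change of the probability of finding [u], i.e. [|u* A u| <= (tr |A|) / 2]
    for traceless [A] ([norm_qform_traceless_le]).  It is the duality between
    the trace norm and the operator norm ([norm_trace_unitary_le]), tested on
    the reflection [2 uu* - 1].

    Finally, in an eigenbasis of the effect of [w], the probability of [w] in
    an arbitrary state is a weighted mean of its probabilities on the basis
    vectors ([outcome_prob_mean]), so the bound for orthonormal pairs passes
    to all pairs of states, and [K ^ 2 = exp (2 ln K)]. *)

(** * Real inequalities *)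

(** Here [c] and [e] are the unnormalized overlaps with [u] of the two measured
    components.  The value [t = 1/2 - alpha] is the one for which a likelihood
    ratio [K ^ 2] sends the prior weight [t] exactly to [1 - t], a jump of
    [2 alpha].  Everything is multiplied by the denominator
    [t a + (1 - t) b], so that [b = 0] is not a special case. *)
Lemma mixing_ratio (R : realFieldType) (alpha a b c e : R)
    (t := 1 / 2 - alpha) :
  0 <= alpha < 1 / 2 -> 0 <= b -> 0 <= e ->
  a - c <= alpha * a ->
  t * c + (1 - t) * e - t * (t * a + (1 - t) * b)
    <= alpha * (t * a + (1 - t) * b) ->
  a <= ((1 + 2 * alpha) / (1 - 2 * alpha)) ^+ 2 * b.
Proof.
move=> /andP[al0 al1] b0 e0 ac mix.
have t0 : 0 < t by rewrite /t; lra.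
have se0 : 0 <= (1 - t) * e by apply: mulr_ge0 => //; rewrite /t; lra.
have tc : t * ((1 - alpha) * a) <= t * c by rewrite ler_pM2l //; lra.
have tab : t * ((1 - alpha) * a) <= (t + alpha) * (t * a + (1 - t) * b) by lra.
(* Since [t + alpha = 1/2], the bound [tab] is
   [(1 - 2 alpha) ^ 2 * a <= (1 + 2 alpha) * b]; the products [alpha * b] and
   [alpha ^ 2 * b] pay for the missing factor [1 + 2 alpha]. *)
have ab0 := mulr_ge0 al0 b0.
have aab0 := mulr_ge0 al0 ab0.
have X0 : 0 < 1 - 2 * alpha by lra.
rewrite expr_div_n mulrAC ler_pdivlMr ?exprn_gt0 //.
move: tab; rewrite /t; lra.
Qed.

Lemma weighted_mean_ratio (R : numDomainType) (I : finType) (K : R)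
    (c1 c2 s : I -> R) :
  (forall i, 0 <= c1 i) -> \sum_i c1 i = 1 ->
  (forall i, 0 <= c2 i) -> \sum_i c2 i = 1 ->
  (forall i j, s i <= K * s j) ->
  \sum_i c1 i * s i <= K * \sum_i c2 i * s i.
Proof.
move=> c1_ge0 c1_sum c2_ge0 c2_sum s_le.
rewrite -[leRHS]mul1r -c1_sum mulr_suml; apply: ler_sum => i _.
apply: ler_wpM2l => //; rewrite -[leLHS]mul1r -c2_sum mulr_suml mulr_sumr.
by apply: ler_sum => j _; rewrite mulrCA ler_wpM2l.
Qed.

(** * Quadratic forms and the dual bound for the trace norm *)

Section QuadraticForm.
Local Open Scope sesquilinear_scope.
Context {C : numClosedFieldType} {d : nat}.
Implicit Types (A B Q : 'M[C]_d) (u v : 'cV[C]_d).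

Definition qform A u : C := (u ^t* *m A *m u) 0 0.

Lemma qformD A B u : qform (A + B) u = qform A u + qform B u.
Proof. by rewrite /qform mulmxDr mulmxDl mxE. Qed.

Lemma qformB A B u : qform (A - B) u = qform A u - qform B u.
Proof. by rewrite /qform mulmxBr mulmxBl !mxE. Qed.

Lemma qformZ a A u : qform (a *: A) u = a * qform A u.
Proof. by rewrite /qform -scalemxAr -scalemxAl mxE. Qed.

Lemma qform_dyad u v :
  qform (v *m v ^t*) u = `|(u ^t* *m v) 0 0| ^+ 2.
Proof.
rewrite /qform mulmxA -[_ *m v *m _ *m u]mulmxA [in LHS]mxE big_ord1 normCK.
congr (_ * _); rewrite -[u in _ *m u]trmxCK -map_mxM -trmx_mul.
by rewrite !mxE.
Qed.

Lemma qform_conj A Q u :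
  qform (Q *m A *m Q ^t*) u = qform A (Q ^t* *m u).
Proof. by rewrite /qform trmx_mul map_mxM trmxCK !mulmxA. Qed.

Lemma mxtrace_dyad A u : \tr (u *m u ^t* *m A) = qform A u.
Proof. by rewrite -mulmxA mxtrace_mulC trace_mx11. Qed.

Lemma qform_conj_comb (a b : C) A B Q u :
  qform (Q *m (a *: A + b *: B) *m Q ^t*) u =
  a * qform (Q *m A *m Q ^t*) u + b * qform (Q *m B *m Q ^t*) u.
Proof. by rewrite !qform_conj qformD !qformZ. Qed.

Lemma mxtrace_mul_comb (a b : C) A B Q :
  \tr ((a *: A + b *: B) *m Q) = a * \tr (A *m Q) + b * \tr (B *m Q).
Proof. by rewrite mulmxDl -!scalemxAl linearD !linearZ. Qed.

Lemma qform_row A Q i : qform A (col i (Q ^t*)) = (Q *m A *m Q ^t*) i i.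
Proof.
have -> : col i (Q ^t*) = Q ^t* *m delta_mx i 0 by rewrite colE.
by rewrite -qform_conj /qform -mulmxA -colE trmx_delta map_delta_mx -rowE !mxE.
Qed.

Lemma psd_trace_conj_ge0 A Q : psdmx A -> 0 <= \tr (Q *m A *m Q ^t*).
Proof.
by case=> _ A_ge0; apply: sumr_ge0 => i _; rewrite -qform_row; exact: A_ge0.
Qed.

(** Both traces are computed in the eigenbasis of [A^* A].  There the [i]-th
    diagonal entry of [Q A] pairs a unit vector with a vector of squared norm
    the [i]-th eigenvalue of [A^* A], and Cauchy-Schwarz compares it with the
    [i]-th eigenvalue of [|A|]. *)
Lemma norm_trace_unitary_le A Q :
  Q \is unitarymx -> `|\tr (Q *m A)| <= \tr (absmx A).
Proof.
move=> QU; set P := spectralmx (A ^t* *m A).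
set s := spectral_diag (A ^t* *m A).
have PU : P \is unitarymx by exact: spectral_unitarymx.
have dotE (X Y : 'M[C]_d) i : dotmx (row i X) (row i Y) = (X *m Y ^t*) i i.
  by rewrite dotmxE !mxE; apply: eq_bigr => k _; rewrite !mxE.
have -> : \tr (Q *m A) = \tr (P *m Q *m (P *m A ^t*) ^t*).
  rewrite trmx_mul map_mxM trmxCK mulmxA [RHS]mxtrace_mulC !mulmxA.
  by rewrite -invmx_unitary // mulVmx ?mul1mx ?unitarymx_unit.
have -> : \tr (absmx A) = \sum_i sqrtC (s 0 i).
  rewrite /absmx /sqrtmx mxtrace_mulC mulmxA mulmxV ?unitarymx_unit //.
  by rewrite mul1mx mxtrace_diag; apply: eq_bigr => i _; rewrite mxE.
apply: le_trans (ler_norm_sum _ _ _) _; apply: ler_sum => i _.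
rewrite -dotE; apply: le_trans (CauchySchwarz_sqrt (@dotmx C d) _ _) _.
rewrite /= !dotE (unitarymxP (mul_unitarymx PU QU)) mxE eqxx sqrtC1 mul1r.
rewrite trmx_mul map_mxM trmxCK -mulmxA [A ^t* *m _]mulmxA.
rewrite gram_spectralE -/P -/s.
rewrite !mulmxA (unitarymxP PU) mul1mx -mulmxA (unitarymxP PU) mulmx1.
by rewrite mxE eqxx mulr1n.
Qed.

(** [2 uu* - 1] is a reflection, hence unitary, and its trace against a
    traceless [A] is [2 u* A u]: the tracelessness is what produces the factor
    [1/2] of the trace distance. *)
Lemma norm_qform_traceless_le A u :
  u ^t* *m u = 1%:M -> \tr A = 0 -> `|qform A u| <= \tr (absmx A) / 2.
Proof.
move=> u1 trA.
have TU : (2 *: (u *m u ^t*) - 1%:M : 'M[C]_d) \is unitarymx.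
  apply/unitarymxP; rewrite raddfB /= map_mxB linearZ /= map_mxZ.
  rewrite trmx_mul map_mxM trmxCK trmx1 map_mx1 rmorph_nat.
  rewrite mulmxBl mul1mx mulmxBr mulmx1 -scalemxAl -scalemxAr scalerA.
  rewrite -[u *m _ *m (u *m _)]mulmxA [u ^t* *m (_ *m _)]mulmxA u1 mul1mx.
  by rewrite mulr_natl mulr2n scalerDl addrK subKr.
have := norm_trace_unitary_le A _ TU.
rewrite mulmxBl mul1mx -scalemxAl linearB linearZ /= mxtrace_dyad trA subr0.
by rewrite normrM normr_nat ler_pdivlMr ?ltr0n // mulrC.
Qed.

End QuadraticForm.

(** * States and outcome probabilities *)

Section GentlePrivacy.
Local Open Scope sesquilinear_scope.
Context {R : realType} {d : nat} {Omega : countType}.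
Implicit Types (rho : 'M[R[i]]_d) (u v : 'cV[R[i]]_d) (w : Omega).
Implicit Types (M : Omega -> 'M[R[i]]_d) (alpha : R).

Lemma Re_realM (a : R) (z : R[i]) :
  complex.Re (a%:C%C * z) = a * complex.Re z.
Proof. by case: z => x y /=; rewrite mul0r subr0. Qed.

Lemma Re_comb (a b : R) (x y : R[i]) :
  complex.Re (a%:C%C * x + b%:C%C * y) = a * complex.Re x + b * complex.Re y.
Proof. by rewrite -!Re_realM; case: (_ * x) => ? ?; case: (_ * y). Qed.

Lemma Re_sub (x y : R[i]) : complex.Re (x - y) = complex.Re x - complex.Re y.
Proof. by case: x y => [a b] [c e]. Qed.

Lemma dyad_density u :
  u ^t* *m u = 1%:M -> density_matrices R d (u *m u ^t*).
Proof.
move=> u1; split; last by rewrite mxtrace_mulC u1 trace_mx11 mxE.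
split=> [|v]; last by rewrite [X in _ <= X]qform_dyad exprn_ge0.
by apply/is_hermitianmxP; rewrite expr0 scale1r trmx_mul map_mxM trmxCK.
Qed.

Lemma density_convex (t : R) rho1 rho2 :
  0 <= t <= 1 -> density_matrices R d rho1 -> density_matrices R d rho2 ->
  density_matrices R d (t%:C%C *: rho1 + (1 - t)%:C%C *: rho2).
Proof.
move=> /andP[t0 t1] [[h1 p1] tr1] [[h2 p2] tr2].
have tc0 : 0 <= t%:C%C by rewrite ler0c.
have sc0 : 0 <= (1 - t)%:C%C by rewrite ler0c subr_ge0.
split; last first.
  rewrite linearD !linearZ /= tr1 tr2 !mulr1 -rmorphD /=.
  by rewrite addrC subrK.
split=> [|u]; last first.
  rewrite -/(qform _ u) qformD !qformZ addr_ge0 // mulr_ge0 //.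
    exact: p1.
  exact: p2.
move/is_hermitianmxP : h1; move/is_hermitianmxP : h2.
rewrite !expr0 !scale1r => h2 h1; apply/is_hermitianmxP.
rewrite expr0 scale1r linearD !linearZ /= map_mxD !map_mxZ /= -h1 -h2.
by congr (_ *: _ + _ *: _); apply/esym/CrealP/ger0_real.
Qed.

Lemma mxtrace_effect M rho w :
  \tr (rho *m effect M w) = \tr (M w *m rho *m (M w) ^t*).
Proof. by rewrite mxtrace_mulC [RHS]mxtrace_mulC mulmxA. Qed.

Lemma outcome_probE M rho w : psdmx rho ->
  \tr (rho *m effect M w) = (outcome_prob M rho w)%:C%C.
Proof.
move=> rho_psd; rewrite /outcome_prob RRe_real // ger0_real //.
by rewrite mxtrace_effect psd_trace_conj_ge0.
Qed.

Lemma outcome_prob_ge0 M rho w : psdmx rho -> 0 <= outcome_prob M rho w.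
Proof.
move=> rho_psd; rewrite -ler0c -outcome_probE // mxtrace_effect.
exact: psd_trace_conj_ge0.
Qed.

(** * Gentleness bounds likelihood ratios *)

(** [Re (u* rho u)] is the probability of finding the state [rho] along [u];
    it changes by at most the trace distance.  The inequality is multiplied by
    the outcome probability, which makes its second term linear in [rho]. *)
Lemma gentle_qform_le alpha M rho u w :
  gentle alpha (density_matrices R d) M -> density_matrices R d rho ->
  u ^t* *m u = 1%:M ->
  0 < outcome_prob M rho w ->
  `|outcome_prob M rho w * complex.Re (qform rho u)
    - complex.Re (qform (M w *m rho *m (M w) ^t*) u)|
  <= alpha * outcome_prob M rho w.
Proof.
move=> gM rhoS u1 p_gt0; have := gM _ _ rhoS p_gt0.
case: (rhoS) => rho_psd rho1; set p := outcome_prob M rho w in p_gt0 *.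
have pE : \tr (rho *m effect M w) = p%:C%C by exact: outcome_probE.
have p_neq0 : p%:C%C != 0 by rewrite fmorph_eq0 gt_eqF.
set D := rho - post_state M rho w => D_le.
have D_tr : \tr D = 0.
  by rewrite linearB /= rho1 linearZ /= -mxtrace_effect pE mulVf // subrr.
have -> : p * complex.Re (qform rho u)
    - complex.Re (qform (M w *m rho *m (M w) ^t*) u) =
    p * complex.Re (qform D u).
  rewrite -!Re_realM qformB /post_state qformZ pE mulrBr mulVKf //.
  by rewrite Re_sub.
rewrite normrM gtr0_norm // mulrC ler_pM2r //.
apply: le_trans D_le; rewrite /trace_norm -lecR.
have tr_ge := norm_qform_traceless_le _ _ u1 D_tr.
apply: le_trans (normc_ge_Re _) (le_trans tr_ge _).
have : 0 <= \tr (absmx D).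
  have := le_trans (normr_ge0 _) tr_ge.
  by rewrite pmulr_lge0 // invr_gt0 ltr0n.
by move=> /ger0_real/RRe_real => {1}<-; rewrite rmorphM fmorphV rmorph_nat.
Qed.

(** The mixture [rho] of [uu*] and [vv*] is found along [u] with probability
    exactly [t] because [u] and [v] are orthogonal.  After the measurement the
    contribution [F rv] of the other component can only increase this
    probability, and [gentle_qform_le] on [ru] and on [rho] gives the two
    inequalities of [mixing_ratio]. *)
Lemma gentle_orthonormal_ratio alpha M u v w :
  0 <= alpha < 1 / 2 -> gentle alpha (density_matrices R d) M ->
  u ^t* *m u = 1%:M -> v ^t* *m v = 1%:M -> u ^t* *m v = 0 ->
  outcome_prob M (u *m u ^t*) w <=
  ((1 + 2 * alpha) / (1 - 2 * alpha)) ^+ 2 * outcome_prob M (v *m v ^t*) w.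
Proof.
move=> al gM u1 v1 uv; have /andP[al0 al1] := al.
pose t : R := 1 / 2 - alpha.
have t_gt0 : 0 < t by rewrite /t; lra.
have s_ge0 : 0 <= 1 - t by rewrite /t; lra.
pose F rho := complex.Re (qform (M w *m rho *m (M w) ^t*) u).
have uS := dyad_density _ u1; have vS := dyad_density _ v1.
set ru := u *m u ^t* in uS *; set rv := v *m v ^t* in vS *.
pose rho := t%:C%C *: ru + (1 - t)%:C%C *: rv.
have rhoS : density_matrices R d rho.
  by apply: density_convex => //; rewrite ltW //= -subr_ge0.
have p_rho : outcome_prob M rho w =
    t * outcome_prob M ru w + (1 - t) * outcome_prob M rv w.
  by rewrite /outcome_prob mxtrace_mul_comb Re_comb.
have F_rho : F rho = t * F ru + (1 - t) * F rv.
  by rewrite /F qform_conj_comb Re_comb.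
have qu : complex.Re (qform ru u) = 1.
  by rewrite qform_dyad u1 mxE normr1 expr1n.
have qv : complex.Re (qform rv u) = 0.
  by rewrite qform_dyad uv mxE normr0 expr0n.
have q_rho : complex.Re (qform rho u) = t.
  by rewrite qformD !qformZ Re_comb qu qv mulr1 mulr0 addr0.
have Fv_ge0 : 0 <= F rv.
  rewrite /F qform_conj.
  have := vS.1.2 ((M w) ^t* *m u); rewrite -/(qform _ _).
  by case: (qform _ _) => x y; rewrite lecE /= => /andP[].
have := outcome_prob_ge0 M _ w uS.1.
have b_ge0 := outcome_prob_ge0 M _ w vS.1.
set a := outcome_prob M ru w; set b := outcome_prob M rv w in b_ge0 *.
rewrite le_eqVlt => /predU1P[<-|a_gt0].
  by rewrite mulr_ge0 // sqr_ge0.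
have p_gt0 : 0 < outcome_prob M rho w.
  by rewrite p_rho ltr_wpDr ?mulr_gt0 // mulr_ge0.
have gu : a - F ru <= alpha * a.
  have := gentle_qform_le _ _ _ _ _ gM uS u1 a_gt0.
  by rewrite qu mulr1; apply/le_trans/ler_norm.
have grho : F rho - t * outcome_prob M rho w <= alpha * outcome_prob M rho w.
  have := gentle_qform_le _ _ _ _ _ gM rhoS u1 p_gt0.
  by rewrite q_rho distrC [_ * t]mulrC; apply/le_trans/ler_norm.
rewrite F_rho p_rho -/a -/b in grho.
exact: (mixing_ratio _ alpha _ _ (F ru) (F rv)).
Qed.

(** [f] is an eigenbasis of the effect and the weights are the diagonal entries
    of [rho] in that basis.  The basis depends on the outcome only, so that
    two states can be compared term by term. *)
Lemma outcome_prob_mean M w :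
  exists f : 'I_d -> 'cV[R[i]]_d,
    (forall i j, (f i) ^t* *m f j = (i == j)%:R%:M) /\
    forall rho, density_matrices R d rho -> exists c : 'I_d -> R,
      [/\ forall i, 0 <= c i, \sum_i c i = 1 &
        outcome_prob M rho w =
        \sum_i c i * outcome_prob M (f i *m (f i) ^t*) w].
Proof.
set P := spectralmx (effect M w); set s := spectral_diag (effect M w).
have PU : P \is unitarymx by exact: spectral_unitarymx.
have PPt : P *m P ^t* = 1%:M by exact/unitarymxP.
have EE : effect M w = P ^t* *m diag_mx s *m P by exact: gram_spectralE.
pose f i := col i (P ^t*).
have qf i : qform (effect M w) (f i) = s 0 i.
  rewrite qform_row EE !mulmxA PPt mul1mx -mulmxA PPt mulmx1.
  by rewrite mxE eqxx mulr1n.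
exists f; split=> [i j|rho [rho_psd rho1]].
  apply/matrixP=> k l; rewrite !ord1 [RHS]mxE eqxx mulr1n.
  have /matrixP/(_ i j) := PPt; rewrite [in RHS]mxE => <-.
  rewrite !mxE; apply: eq_bigr => h _.
  by rewrite !mxE conjCK.
have c_ge0 i : 0 <= qform rho (f i) by exact: rho_psd.2.
have cE i : (complex.Re (qform rho (f i)))%:C%C = qform rho (f i).
  by rewrite RRe_real // ger0_real.
exists (fun i => complex.Re (qform rho (f i))); split.
- by move=> i; rewrite -ler0c cE.
- apply: (fmorph_inj (real_complex R)); rewrite rmorph1 rmorph_sum /=.
  rewrite -rho1 -[rho in RHS]mulmx1.
  have <- : P ^t* *m P = 1%:M.
    by rewrite -invmx_unitary // mulVmx ?unitarymx_unit.
  rewrite mulmxA mxtrace_mulC mulmxA; apply: eq_bigr => i _.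
  by rewrite cE qform_row.
apply: (fmorph_inj (real_complex R)); rewrite /= -outcome_probE //.
rewrite rmorph_sum /= EE mulmxA mxtrace_mulC !mulmxA mul_mx_diag.
apply: eq_bigr => i _; rewrite rmorphM /= cE.
rewrite /outcome_prob mxtrace_dyad qf RRe_real; last first.
  by rewrite ger0_real // gram_spectral_diag_ge0.
by rewrite qform_row mxE.
Qed.

Lemma gentle_outcome_ratio alpha M rho1 rho2 w :
  0 <= alpha < 1 / 2 -> gentle alpha (density_matrices R d) M ->
  density_matrices R d rho1 -> density_matrices R d rho2 ->
  outcome_prob M rho1 w <=
  ((1 + 2 * alpha) / (1 - 2 * alpha)) ^+ 2 * outcome_prob M rho2 w.
Proof.
move=> al gM S1 S2; have /andP[al0 al1] := al.
have [f [fP mean]] := outcome_prob_mean M w.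
have [c1 [c1_ge0 c1_sum ->]] := mean _ S1.
have [c2 [c2_ge0 c2_sum ->]] := mean _ S2.
apply: weighted_mean_ratio => // i j.
have [->|ij] := eqVneq j i.
  have fS : density_matrices R d (f i *m (f i) ^t*).
    by apply: dyad_density; rewrite fP eqxx.
  apply: ler_peMl; first exact: outcome_prob_ge0 fS.1.
  have K_ge1 : 1 <= (1 + 2 * alpha) / (1 - 2 * alpha).
    by rewrite ler_pdivlMr; lra.
  by rewrite expr_ge1 // (le_trans ler01).
apply: gentle_orthonormal_ratio => //; rewrite fP ?eqxx //.
by rewrite eq_sym (negPf ij) raddf0.
Qed.

End GentlePrivacy.

Theorem proposition5 (R : realType) (d : nat) (Omega : countType)
    (alpha : R) (M : Omega -> 'M[R[i]]_d) :
  0 <= alpha < 1 / 2 ->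
  measurement M ->
  gentle alpha (density_matrices R d) M ->
  quantum_dp (2 * ln ((1 + 2 * alpha) / (1 - 2 * alpha)))
    (density_matrices R d) M.
Proof.
move=> al _ gM rho1 rho2 w S1 S2.
rewrite expRM_natl lnK; last by rewrite posrE divr_gt0 //; lra.
exact: gentle_outcome_ratio.
Qed.
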